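(* Let $\varepsilon \in (0,1)$, $q > 0$, and $\alpha > (1+\varepsilon)^{-1}$. Assume that: (i) for every sequence $(y_n)_{n\ge 1}$ of positive reals such that $N_n^{\alpha \varepsilon} \preccurlyeq y_n \preccurlyeq N_n^\alpha$, one has $\log \mathbb{P}(Y_n \geqslant y_n) \sim -q\, y_n^{1-\varepsilon}$ as $n\to\infty$; (ii) $\mathbb{E}[Y_n^2] = o(N_n^{\alpha(1+\varepsilon)-1})$ as $n\to\infty$. Then, for all $y \geqslant 0$, $$\lim_{n \to \infty} \frac{1}{N_n^{\alpha(1-\varepsilon)}} \log \mathbb{P}(T_n \geqslant N_n^{\alpha} y) = - q\, y^{1-\varepsilon}.$$
   Context: For each $n \geqslant 1$, $Y_n$ is a centered real-valued random variable (i.e. integrable with mean $0$), $N_n\ge 1$ is a natural number with $N_n\to\infty$ as $n\to\infty$, and $(Y_{n,i})_{1\le i\le N_n}$ is a family of i.i.d. random variables distributed as $Y_n$. Set $T_n = \sum_{i=1}^{N_n} Y_{n,i}$. The notation $x_n \preccurlyeq y_n$ means $\limsup_{n\to\infty} |x_n/y_n| < \infty$, and $a_n\sim b_n$ means $a_n/b_n\to 1$. *)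

(* Defs.v *)
(* MathComp-Analysis *)
From HB Require Import structures.
From mathcomp Require Import all_boot all_order all_algebra.
From mathcomp Require Import all_classical all_reals all_analysis.
Import Order.TTheory GRing.Theory Num.Theory.
Import numFieldNormedType.Exports.

Set Implicit Arguments.
Unset Strict Implicit.
Unset Printing Implicit Defensive.

Local Open Scope classical_set_scope.
Local Open Scope ring_scope.

Section sequences.
Context {R : realType}.

Definition asymp_le (x y : nat -> R) : Prop :=
  (limn_esup (fun n => `|x n / y n|%:E) < +oo)%E.

(* [a] is extended-real valued below, so that it may be the logarithm of a
   probability (-oo when the probability vanishes) or a second moment (possibly
   +oo); when [b] does not vanish, either limit makes [a n] finite for all
   large [n]. *)
Definition asymp_equiv (a : nat -> \bar R) (b : nat -> R) : Prop :=
  (fun n => (a n * (b n)^-1%:E)%E) @ \oo --> 1%E.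

Definition little_o (a : nat -> \bar R) (b : nat -> R) : Prop :=
  (fun n => (a n * (b n)^-1%:E)%E) @ \oo --> 0%E.

End sequences.

Section random_variables.
Context d {Omega : measurableType d} {R : realType} (P : probability Omega R).

Definition mutually_independent (I : finType) (X : I -> {RV P >-> R}) : Prop :=
  forall (J : {set I}) (B : I -> set R), (forall i, measurable (B i)) ->
    P (\bigcap_(i in [set` J]) (X i @^-1` B i)) =
    (\prod_(i in J) P (X i @^-1` B i))%E.

Definition identically_distributed (X Y : {RV P >-> R}) : Prop :=
  forall B : set R, measurable B -> distribution P X B = distribution P Y B.

Definition centered (X : {RV P >-> R}) : Prop :=
  P.-integrable setT (EFin \o X) /\ ('E_P[X] = 0)%E.

End random_variables.

(* Main.v *)
(* A single big jump governs the deviation.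

   Lower bound: one summand exceeds N^alpha (y + delta), and the sum of the
   others does not fall below - delta N^alpha. Only a second moment is
   available for the latter, but after truncating at the scale N^alpha the
   lower tail is controlled by exp(- t Y), with t of order N^(- alpha).

   Upper bound: either some summand exceeds b = N^alpha y, or all are below b,
   and then Chernoff's bound applies to the summands truncated at b with
   t = q' b^(- eps), q' < q, for which t b = q' b^(1 - eps). The quadratic
   bound on exp handles t Y <= 1 via the second moment, and a decomposition of
   t Y > 1 into unit intervals handles the rest, since there t u <= q' u^(1 - eps)
   is beaten by the tail exp(- q'' u^(1 - eps)), q' < q'' < q. The hypothesis on
   the tail is used uniformly over this range of u, which follows by
   applying it to a sequence of counterexamples. *)
Require Import Defs.
From HB Require Import structures.
From mathcomp Require Import all_boot all_order all_algebra.
From mathcomp Require Import all_classical all_reals all_analysis.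
From mathcomp Require Import measurable_realfun ring lra.
Import Order.TTheory GRing.Theory Num.Theory.
Import numFieldNormedType.Exports.

Set Implicit Arguments.
Unset Strict Implicit.
Unset Printing Implicit Defensive.

Local Open Scope classical_set_scope.
Local Open Scope ring_scope.

(** * Expectation of a product of independent variables *)

Section product_expectation.
Local Open Scope ereal_scope.
Context d (T : measurableType d) (R : realType) (P : probability T R).

Import HBNNSimple.

(** The factorization passes from indicators to simple functions by linearity, then to [f] by
    monotone convergence along [nnsfun_approx]. In the application [g] is the product of the
    remaining factors and [c] its expectation. *)
Lemma integral_mul_comp (X : {RV P >-> R}) (g : T -> R) (f : R -> R) (c : R) :
    measurable_fun setT g -> (forall w, 0 <= g w)%R ->
    measurable_fun setT f -> (forall x, 0 <= f x)%R ->
    (forall B, measurable B ->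
      \int[P]_w (g w * \1_B (X w))%:E = c%:E * P (X @^-1` B)) ->
  \int[P]_w (g w * f (X w))%:E = c%:E * \int[P]_w (f (X w))%:E.
Proof.
move=> mg g0 mf f0 gB.
have mX : measurable_fun setT X by [].
have mf' : measurable_fun setT (EFin \o f) by exact/measurable_EFinP.
pose f_ := nnsfun_approx measurableT mf'.
have mfX n : measurable_fun setT (fun w => f_ n (X w)).
  by apply: measurableT_comp.
have cvgf x : (f_ n x)%:E @[n --> \oo] --> (f x)%:E.
  by apply: (@cvg_nnsfun_approx _ _ _ _ measurableT _ mf') => // y _; rewrite lee_fin.
have ndf x m n : (m <= n)%N -> (f_ m x <= f_ n x)%R.
  by move=> mn; exact/lefP/nd_nnsfun_approx.
have step n : \int[P]_w (g w * f_ n (X w))%:E = c%:E * \int[P]_w (f_ n (X w))%:E.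
  pose A k := X @^-1` (f_ n @^-1` [set k]).
  have mA k : measurable (A k) by rewrite /A -[A in measurable A]setTI; exact: mX.
  have E w : f_ n (X w) = (\sum_(y \in range (f_ n)) y * \1_(A y) w)%R.
    by rewrite fimfunE.
  transitivity (\sum_(y \in range (f_ n)) y%:E * (c%:E * P (A y))).
    transitivity (\int[P]_w
       (\sum_(y \in range (f_ n)) (g w * (y * \1_(A y) w))%:E)).
      apply: eq_integral => w _; rewrite E fsumEFin// !fsbig_finite//=.
      by rewrite mulr_sumr.
    have m2 y : measurable_fun setT (fun w => (g w * (y * \1_(A y) w))%:E).
      apply/measurable_EFinP; apply: measurable_funM => //.
      by apply: measurable_funM.
    have p2 y w : (y * \1_(A y) w >= 0)%R.
      rewrite indicE; case: (boolP (w \in A y)) => [/set_mem wA|]; last by rewrite mulr0.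
      by rewrite mulr1 -wA.
    rewrite ge0_integral_fsum//; last by move=> y w _; rewrite lee_fin mulr_ge0.
    apply: eq_fsbigr => y /[!inE] -[x _ <-].
    rewrite -gB; last by rewrite -[X in measurable X]setTI; exact: measurable_funP.
    rewrite -ge0_integralZl//; last 3 first.
    - apply/measurable_EFinP; apply: measurable_funM => //.
      by apply: measurableT_comp.
    - by move=> w _; rewrite lee_fin mulr_ge0.
    - by rewrite lee_fin.
    by apply: eq_integral => w _; rewrite -EFinM mulrCA.
  have -> : \int[P]_w (f_ n (X w))%:E = \sum_(y \in range (f_ n)) y%:E * P (A y).
    under eq_integral do rewrite E -fsumEFin//.
    rewrite ge0_integral_fsum//; last 2 first.
    - by move=> y; apply/measurable_EFinP; apply: measurable_funM.
    - move=> y w _; rewrite lee_fin indicE.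
      case: (boolP (w \in A y)) => [/set_mem wA|]; last by rewrite mulr0.
      by rewrite mulr1 -wA.
    apply: eq_fsbigr => y /[!inE] -[x _ <-].
    under eq_integral do rewrite EFinM.
    rewrite ge0_integralZl//; last 2 first.
    - exact/measurable_EFinP.
    - by rewrite lee_fin.
    by rewrite integral_indic// setIT.
  rewrite ge0_mule_fsumr => [|y].
    by apply: eq_fsbigr => y _; rewrite muleCA.
  (* Distributing [c] over the sum needs nonnegative terms; a negative [y] is not a value of [f_ n],
     so its level set is empty. *)
  have [y0|y0] := leP 0%R y; first by rewrite mule_ge0.
  suff -> : A y = set0 by rewrite measure0 mule0.
  apply/seteqP; split => // w /= wy.
  by move: y0; rewrite -wy ltNge fun_ge0.
(* The weight is kept general because both sides are such limits: [h] is [g] on the left and the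
   constant 1 on the right. *)
have mono (h : T -> R) : measurable_fun setT h -> (forall w, 0 <= h w)%R ->
    \int[P]_w (h w * f_ n (X w))%:E @[n --> \oo] --> \int[P]_w (h w * f (X w))%:E.
  move=> mh h0.
  have -> : \int[P]_w (h w * f (X w))%:E =
      \int[P]_w limn (fun n => (h w * f_ n (X w))%:E).
    apply: eq_integral => w _; apply/esym/cvg_lim => //.
    under eq_fun do rewrite EFinM.
    by rewrite EFinM; apply: cvgeZl => //; exact: cvgf.
  apply: cvg_monotone_convergence => //.
  - by move=> n; apply/measurable_EFinP/measurable_funM.
  - by move=> n w _; rewrite lee_fin mulr_ge0.
  - by move=> w _ m n mn; rewrite lee_fin ler_wpM2l// ndf.
have L1 := mono _ mg g0.
have L2 := mono (cst 1%R) (measurable_cst _) (fun=> ler01).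
have E2 (h : R -> R) : \int[P]_w (h (X w))%:E = \int[P]_w ((cst 1%R) w * h (X w))%:E.
  by apply: eq_integral => w _; rewrite mul1r.
move: L1; under eq_fun do rewrite step E2.
move=> L1; apply: (cvg_unique _ L1) => //.
by rewrite E2; apply: cvgeZl.
Qed.

Lemma prode_fin_num (I : Type) (s : seq I) (Q : pred I) (f : I -> \bar R) :
  (forall i, Q i -> f i \is a fin_num) -> \prod_(i <- s | Q i) f i \is a fin_num.
Proof.
by move=> h; elim/big_ind : _ => // x y xf yf; rewrite fin_numM.
Qed.

(** [mutually_independent] speaks of events, which is the case of indicators. The indices are then
    released one at a time through [integral_mul_comp]; finiteness of the integrals makes the
    constant there a real number. *)
Lemma independent_integral_prod (I : finType) (X : I -> {RV P >-> R})
    (f : I -> R -> R) :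
    mutually_independent X ->
    (forall i, measurable_fun setT (f i)) -> (forall i x, 0 <= f i x)%R ->
    (forall i, \int[P]_w (f i (X i w))%:E \is a fin_num) ->
  \int[P]_w (\prod_i f i (X i w))%:E = \prod_i \int[P]_w (f i (X i w))%:E.
Proof.
move=> indep; move: f.
(* induction on the list [s] of indices [i] for which [f i] need not be an indicator *)
suff H (s : seq I) (f : I -> R -> R) :
    (forall i, i \notin s -> exists2 B, measurable B & f i = \1_B) ->
    (forall i, measurable_fun setT (f i)) -> (forall i x, 0 <= f i x)%R ->
    (forall i, \int[P]_w (f i (X i w))%:E \is a fin_num) ->
    \int[P]_w (\prod_i f i (X i w))%:E = \prod_i \int[P]_w (f i (X i w))%:E.
  by move=> f; apply: (H (enum I)) => i; rewrite mem_enum.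
have iX i B : measurable B -> measurable (X i @^-1` B).
  by move=> mB; rewrite -[A in measurable A]setTI; exact: measurable_funP.
elim: s f => [|a s IH] f fs mf f0 ffin.
  have /choice[B BP] : forall i, exists B, measurable B /\ f i = \1_B.
    by move=> i; have [//|B] := fs i; exists B.
  transitivity (\int[P]_w (\1_(\bigcap_(i in [set` [set: I]%SET]) (X i @^-1` B i)) w)%:E).
    apply: eq_integral => w _; congr EFin.
    have [wI|/negP wI] := boolP (`[< (\bigcap_(i in [set` [set: I]%SET]) (X i @^-1` B i)) w >]).
      move/asboolP in wI.
      rewrite indicE mem_set// big1// => i _; rewrite (BP i).2 indicE mem_set//.
      by apply: wI; rewrite /= finset.inE.
    rewrite indicE memNset; last by move=> h; apply: wI; apply/asboolP.
    have [i wi] : exists i, ~ B i (X i w).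
      apply: contrapT => /forallNP h; apply: wI; apply/asboolP => i _.
      exact: contrapT (h i).
    by rewrite (bigD1 i)//= (BP i).2 indicE memNset// mul0r.
  rewrite integral_indic//; last first.
    by apply: fin_bigcap_measurable => [|i _]; [exact: finite_finset|apply: iX; exact: (BP i).1].
  rewrite setIT; transitivity (\prod_(i in [set: I]%SET) P (X i @^-1` B i)).
    by apply: indep => i; exact: (BP i).1.
  apply: congr_big => // [i|i _]; first by rewrite finset.inE.
  rewrite (BP i).2 -[RHS]/(\int[P]_w (\1_(X i @^-1` B i) w)%:E) integral_indic ?setIT//.
  by apply: iX; exact: (BP i).1.
pose c := \prod_(i | i != a) \int[P]_w (f i (X i w))%:E.
have cfin : c \is a fin_num by exact: prode_fin_num.
rewrite [RHS](bigD1 a)//= -/c muleC -(fineK cfin).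
pose g w := (\prod_(i | i != a) f i (X i w))%R.
transitivity (\int[P]_w (g w * f a (X a w))%:E).
  by apply: eq_integral => w _; rewrite (bigD1 a)//= mulrC.
apply: integral_mul_comp => //.
- rewrite /g; under eq_fun do rewrite -big_filter.
  by apply: measurable_prod => i _; apply: measurableT_comp.
- by move=> w; apply: prodr_ge0.
move=> B mB.
(* Testing against [B] puts an indicator at [a], so the induction hypothesis applies to [f']. *)
pose f' i := if i == a then \1_B else f i.
have f'a : f' a = \1_B by rewrite /f' eqxx.
have f'N i : i != a -> f' i = f i by rewrite /f' => /negbTE ->.
have intB : \int[P]_w (\1_B (X a w))%:E = P (X a @^-1` B).
  rewrite -[LHS]/(\int[P]_w (\1_(X a @^-1` B) w)%:E) integral_indic ?setIT//.
  exact: iX.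
transitivity (\int[P]_w (\prod_i f' i (X i w))%:E).
  apply: eq_integral => w _; rewrite [in RHS](bigD1 a)//= f'a mulrC; congr (_ * _)%:E.
  by apply: eq_bigr => i /f'N ->.
rewrite IH; first last.
- move=> i; have [->|/f'N -> //] := eqVneq i a.
  by rewrite f'a intB fin_num_measure//; exact: iX.
- by move=> i x; have [->|/f'N -> //] := eqVneq i a; rewrite f'a.
- by move=> i; have [->|/f'N -> //] := eqVneq i a; rewrite f'a.
- move=> i si; have [->|ia] := eqVneq i a; first by rewrite f'a; exists B.
  by rewrite f'N//; apply: fs; rewrite inE negb_or ia.
rewrite (bigD1 a)//= f'a intB muleC fineK//; congr (_ * _).
by apply: eq_bigr => i /f'N ->.
Qed.

End product_expectation.

(** * Pointwise bounds on the exponential *)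

(** Since [expR x] is the inverse square of [expR (- (x / 2))], it is at most the inverse of
    [(1 - x / 2) ^+ 2]. What remains is a polynomial inequality, whose two sides differ by
    [x ^+ 2 * ((1 - x) * (5 / 4 - x / 2))]. *)
Lemma expR_le_quad (R : realType) (x : R) :
  x <= 1 -> expR x <= 1 + x + 2 * x ^+ 2.
Proof.
move=> x1; have h := expR_ge1Dx (- (x / 2)).
have e1 : expR x * expR (- (x / 2)) ^+ 2 = 1.
  rewrite expr2 -!expRD (_ : x + _ = 0) ?expR0//; lra.
have e0 := expR_gt0 x.
have l0 : 0 < (1 - x / 2) ^+ 2 by rewrite exprn_gt0//; lra.
rewrite -(ler_pM2r l0) (@le_trans _ _ 1)//.
  rewrite -[leRHS]e1 ler_pM2l// ler_pXn2r// nnegrE; lra.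
rewrite -subr_ge0 (_ : _ - 1 = x ^+ 2 * ((1 - x) * (5 / 4 - x / 2))); last by field.
apply: mulr_ge0; first exact: sqr_ge0.
by apply: mulr_ge0; lra.
Qed.

(** Beyond 1, the single term with [k.+1] the integer part of [x] already dominates, because
    [x < k.+2]; all other terms are nonnegative. *)
Lemma expR_le_quad_sum (R : realType) (x : R) (K : nat) :
    x < K.+1%:R ->
  expR x <= 1 + x + 2 * x ^+ 2 +
    \sum_(k < K) expR k.+2%:R * \1_(`[k.+1%:R, +oo[%classic) x.
Proof.
move=> xK; have q0 : 0 <= 1 + x + 2 * x ^+ 2 by nra.
have s0 k : 0 <= expR k.+2%:R * \1_(`[k.+1%:R, +oo[%classic) x :> R.
  by rewrite mulr_ge0// expR_ge0.
have [x1|x1] := leP x 1.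
  by rewrite (le_trans (expR_le_quad x1))// lerDl sumr_ge0.
have x0 : 0 <= x by rewrite (le_trans ler01)// ltW.
have /andP[k1 k2] := truncn_itv x0.
have kpos : (0 < Num.truncn x)%N by rewrite truncn_gt0 ltW.
have kK : ((Num.truncn x).-1 < K)%N.
  by rewrite prednK// -ltnS -(ltr_nat R) (le_lt_trans k1).
set S := \sum_(k < K) _; apply: (@le_trans _ _ S); last by rewrite lerDr.
rewrite /S (bigD1 (Ordinal kK))//= prednK// -[leLHS]addr0 lerD//.
  by rewrite indicE mem_set ?mulr1 ?ler_expR ?ltW//= in_itv/= k1.
by rewrite sumr_ge0.
Qed.

(** * Integrals that depend only on the law *)

Section identically_distributed.
Local Open Scope ereal_scope.
Context d (T : measurableType d) (R : realType) (P : probability T R).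

Lemma identically_distributed_integral (X Z : {RV P >-> R}) (f : R -> R) :
    identically_distributed X Z ->
    measurable_fun setT f -> (forall x, 0 <= f x)%R ->
  \int[P]_w (f (X w))%:E = \int[P]_w (f (Z w))%:E.
Proof.
move=> XZ mf f0.
have mf' : measurable_fun setT (EFin \o f) by exact/measurable_EFinP.
have f0' y : 0 <= (EFin \o f) y by rewrite lee_fin.
transitivity (\int[distribution P X]_x (f x)%:E).
  by rewrite (ge0_integral_distribution _ mf').
transitivity (\int[distribution P Z]_x (f x)%:E); last first.
  by rewrite (ge0_integral_distribution _ mf').
by apply: eq_measure_integral => A mA _; exact: XZ.
Qed.

Lemma measurable_RV_ge (X : {RV P >-> R}) (b : R) : measurable [set w | (b <= X w)%R].
Proof.
rewrite (_ : [set w | _] = X @^-1` `[b, +oo[).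
  by rewrite -[A in measurable A]setTI; exact: measurable_funP.
by apply/seteqP; split => w /=; rewrite in_itv/= andbT.
Qed.

Lemma integral_indic_ge (X : {RV P >-> R}) (b : R) :
  \int[P]_w (\1_(`[b, +oo[%classic) (X w))%:E = P [set w | (b <= X w)%R].
Proof.
transitivity (\int[P]_w (\1_[set w | (b <= X w)%R] w)%:E); last first.
  by rewrite integral_indic ?setIT//; exact: measurable_RV_ge.
apply: eq_integral => w _; congr EFin; rewrite !indicE; congr (_%:R); congr nat_of_bool.
by apply/idP/idP; rewrite !inE/= in_itv/= andbT.
Qed.

(** Centering kills the linear term, so only the second moment and the remainder [g] survive
    integration. *)
Lemma integral_le_quad (Z : {RV P >-> R}) (t v : R) (f g : R -> R) :
    centered Z -> \int[P]_w ((Z w) ^+ 2)%:E = v%:E ->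
    measurable_fun setT f -> (forall x, 0 <= f x)%R ->
    measurable_fun setT g -> (forall x, 0 <= g x)%R ->
    (forall x, f x <= 1 + t * x + 2 * (t * x) ^+ 2 + g x)%R ->
  \int[P]_w (f (Z w))%:E <= (1 + 2 * t ^+ 2 * v)%:E + \int[P]_w (g (Z w))%:E.
Proof.
move=> [iZ EZ] sq mf f0 mg g0 fg.
pose h x := (1 + t * x + 2 * (t * x) ^+ 2)%R.
have h0 x : (0 <= h x)%R by rewrite /h; nra.
have mh : measurable_fun setT h.
  rewrite /h; apply: measurable_funD; first by apply: measurable_funD => //; exact: measurable_funM.
  apply: measurable_funM => //; apply: measurable_funX; exact: measurable_funM.
have mc (k : R -> R) : measurable_fun setT k -> measurable_fun setT (fun w => (k (Z w))%:E).
  by move=> mk; apply/measurable_EFinP; exact: measurableT_comp.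
apply: (@le_trans _ _ (\int[P]_w ((h (Z w))%:E + (g (Z w))%:E))).
  apply: ge0_le_integral => //.
  - by move=> w _; rewrite lee_fin.
  - exact: mc.
  - by apply: emeasurable_funD; exact: mc.
  - by move=> w _; rewrite -EFinD lee_fin; exact: fg.
rewrite ge0_integralD//; [|by move=> w _; rewrite lee_fin|exact: mc|
  by move=> w _; rewrite lee_fin|exact: mc].
rewrite leeD2r//.
have iq : P.-integrable setT (fun w => (Z w ^+ 2)%:E).
  apply/integrableP; split; first by apply: (mc (fun x => x ^+ 2)%R); exact: measurable_funX.
  under eq_integral do rewrite gee0_abs ?lee_fin ?sqr_ge0//.
  by rewrite sq ltry.
have EZ' : \int[P]_w (Z w)%:E = 0 by move: EZ; rewrite unlock.
have -> : \int[P]_w (h (Z w))%:E =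
   \int[P]_w ((1%:E + t%:E * (Z w)%:E) + (2 * t ^+ 2)%:E * (Z w ^+ 2)%:E).
  by apply: eq_integral => w _; rewrite /h -!EFinM -!EFinD exprMn mulrA.
have i1 : P.-integrable setT (cst 1%:E).
  by apply: finite_measure_integrable_cst.
have i2 : P.-integrable setT (fun w => t%:E * (Z w)%:E) by exact: integrableZl.
have i3 : P.-integrable setT (fun w => (2 * t ^+ 2)%:E * (Z w ^+ 2)%:E) by exact: integrableZl.
rewrite integralD//; last exact: integrableD.
rewrite integralD// integralZl// integralZl// EZ' mule0 adde0 sq.
rewrite integral_cst//.
rewrite [X in 1 * X](_ : _ = 1) ?mule1 -?EFinM -?EFinD//; exact: probability_setT.
Qed.

End identically_distributed.

(** * Bounds for i.i.d. sums of fixed size *)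

Section iid_sum.
Local Open Scope ereal_scope.
Context d (T : measurableType d) (R : realType) (P : probability T R).
Context (I : finType) (X : I -> {RV P >-> R}) (Z : {RV P >-> R}).
Hypothesis indepX : mutually_independent X.
Hypothesis distrX : forall i, identically_distributed (X i) Z.

Let mcomp (W : {RV P >-> R}) (f : R -> R) :
  measurable_fun setT f -> measurable_fun setT (fun w => (f (W w))%:E).
Proof. by move=> mf; apply/measurable_EFinP; exact: measurableT_comp. Qed.

Lemma iid_integral_prod (f : I -> R -> R) (e : I -> R) :
    (forall i, measurable_fun setT (f i)) -> (forall i x, 0 <= f i x)%R ->
    (forall i, \int[P]_w (f i (Z w))%:E = (e i)%:E) ->
  \int[P]_w (\prod_i f i (X i w))%:E = (\prod_i e i)%:E.
Proof.
move=> mf f0 fe.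
have fXe i : \int[P]_w (f i (X i w))%:E = (e i)%:E.
  by rewrite (identically_distributed_integral (distrX i)).
rewrite independent_integral_prod//; last by move=> i; rewrite fXe.
rewrite (eq_bigr (fun i => (e i)%:E)) => [|i _]; last exact: fXe.
by rewrite -(big_morph EFin EFinM erefl).
Qed.

Lemma measurable_iid_sum_ge (b : R) :
  measurable [set w | (b <= \sum_i X i w)%R].
Proof.
rewrite (_ : [set w | _] = (fun w => \sum_i X i w)%R @^-1` `[b, +oo[).
  rewrite -[A in measurable A]setTI; apply: measurable_sum => //.
by apply/seteqP; split => w /=; rewrite in_itv/= andbT.
Qed.

(** Either some summand reaches [b], which the union bound handles, or no truncation is active and
    the product of the factors is the full exponential of [t] times the sum, at least
    [expR (t * b)]. *)
Lemma iid_sum_ge_le (t b e : R) : (0 <= t)%R ->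
    \int[P]_w (expR (t * Z w) * \1_(`]-oo, b[%classic) (Z w))%:E <= e%:E ->
  P [set w | (b <= \sum_i X i w)%R] <=
    #|I|%:R%:E * P [set w | (b <= Z w)%R] + (expR (- (t * b)) * e ^+ #|I|)%:E.
Proof.
move=> t0.
pose f (x : R) : R := (expR (t * x) * \1_(`]-oo, b[%classic) x)%R.
have mf : measurable_fun setT f.
  by apply: measurable_funM => //; apply: measurableT_comp => //; exact: measurable_funM.
have f0 x : (0 <= f x)%R by rewrite mulr_ge0// expR_ge0.
rewrite -/(\int[P]_w (f (Z w))%:E) => fe.
have E0 : 0 <= \int[P]_w (f (Z w))%:E by apply: integral_ge0 => w _; rewrite lee_fin.
have fin : \int[P]_w (f (Z w))%:E \is a fin_num.
  by rewrite ge0_fin_numE// (le_lt_trans fe)// ltry.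
pose r := fine (\int[P]_w (f (Z w))%:E).
have rE : \int[P]_w (f (Z w))%:E = r%:E by rewrite fineK.
have r0 : (0 <= r)%R by rewrite -lee_fin -rE.
have re : (r <= e)%R by rewrite -lee_fin -rE.
pose A i w : R := \1_(`[b, +oo[%classic) (X i w).
have mA i : measurable_fun setT (EFin \o A i) by exact: mcomp.
have m1 : measurable_fun setT (fun w => (\1_[set w | (b <= \sum_i X i w)%R] w)%:E : \bar R).
  by apply/measurable_EFinP; apply: measurable_indic; exact: measurable_iid_sum_ge.
have mp : measurable_fun setT (fun w => (\prod_i f (X i w))%:E).
  apply/measurable_EFinP; apply: measurable_prod => i _; exact: measurableT_comp.
rewrite -[in leLHS](setIT [set w | _]) -integral_indic//; last exact: measurable_iid_sum_ge.
apply: (@le_trans _ _ (\int[P]_w (\sum_i (A i w)%:E +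
    (expR (- (t * b)))%:E * (\prod_i f (X i w))%:E))).
  apply: ge0_le_integral => //.
  - apply: emeasurable_funD; first exact: emeasurable_sum.
    exact: measurable_funeM.
  move=> w _; rewrite sumEFin -EFinM -EFinD lee_fin indicE.
  have s0 : (0 <= \sum_i A i w)%R by apply: sumr_ge0.
  have p0 : (0 <= expR (- (t * b)) * \prod_i f (X i w))%R.
    by rewrite mulr_ge0 ?expR_ge0 ?prodr_ge0.
  have [/set_mem/= wb|] := boolP (w \in _); last by rewrite addr_ge0.
  have [[i bi]|/forallNP h] := pselect (exists i, (b <= X i w)%R).
    apply: (@le_trans _ _ (\sum_i A i w)%R); last by rewrite lerDl.
    rewrite (bigD1 i)//= /A indicE mem_set/= ?in_itv/= ?bi// lerDl.
    by apply: sumr_ge0.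
  apply: (@le_trans _ _ (expR (- (t * b)) * \prod_i f (X i w))%R); last by rewrite lerDr.
  rewrite (eq_bigr (fun i => expR (t * X i w))) => [|i _]; last first.
    by rewrite /f indicE mem_set ?mulr1//= in_itv/= ltNge; apply/negP.
  rewrite -expR_sum -expRD -mulr_sumr -expR0 ler_expR.
  by rewrite addrC subr_ge0 ler_wpM2l.
rewrite ge0_integralD//; first last.
- exact: measurable_funeM.
- by move=> w _; rewrite -EFinM lee_fin mulr_ge0 ?expR_ge0 ?prodr_ge0.
- exact: emeasurable_sum.
- by move=> w _; rewrite sumEFin lee_fin sumr_ge0.
apply: leeD.
  rewrite ge0_integral_sum//; last by move=> i w _; rewrite lee_fin.
  rewrite (eq_bigr (fun=> P [set w | (b <= Z w)%R])) => [|i _].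
    rewrite -(fineK (fin_num_measure P _ (measurable_RV_ge Z b))).
    by rewrite sumEFin sumr_const -EFinM mulr_natl.
  rewrite (identically_distributed_integral (f := \1_(`[b, +oo[%classic)) (distrX i))//.
  exact: integral_indic_ge.
rewrite ge0_integralZl//; first last.
- by move=> w _; rewrite lee_fin prodr_ge0.
rewrite (iid_integral_prod (f := fun=> f) (e := fun=> r))//.
rewrite prodr_const -EFinM lee_fin ler_wpM2l ?expR_ge0// lerXn2r//.
by rewrite nnegrE (le_trans r0).
Qed.

(** Let [X i0] make the jump while the total stays below [a - c]. Then either another summand is
    below [- t^-1], which costs [t ^+ 2 * v] for each index by Chebyshev's inequality, or all others
    are above it and sum to less than [- c], which costs an exponential moment. Independence factors
    out the probability of the jump in both cases. *)
Lemma iid_sum_ge_ge (i0 : I) (t a c v : R) : (0 < t)%R -> centered Z ->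
    \int[P]_w (Z w ^+ 2)%:E = v%:E ->
  P [set w | (a <= Z w)%R] <= P [set w | (a - c <= \sum_i X i w)%R] +
    P [set w | (a <= Z w)%R] *
      (#|I|%:R * t ^+ 2 * v + expR (- (t * c)) * (1 + 2 * t ^+ 2 * v) ^+ #|I|)%:E.
Proof.
move=> t0 cZ sq.
(* The cut at [- t^-1] keeps the exponent at most 1, the range where [expR_le_quad] holds. *)
pose f (x : R) : R := (expR (- t * x) * \1_(`[(- t^-1)%R, +oo[%classic) x)%R.
have mf : measurable_fun setT f.
  by apply: measurable_funM => //; apply: measurableT_comp => //; exact: measurable_funM.
have f0 x : (0 <= f x)%R by rewrite mulr_ge0// expR_ge0.
have v0 : (0 <= v)%R.
  by rewrite -lee_fin -sq; apply: integral_ge0 => w _; rewrite lee_fin sqr_ge0.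
have fe : \int[P]_w (f (Z w))%:E <= (1 + 2 * t ^+ 2 * v)%:E.
  apply: le_trans (integral_le_quad (t := (- t)%R) (g := cst 0%R) cZ sq mf f0 _ _ _) _ => //.
    move=> x; rewrite addr0 /f indicE.
    have [/set_mem/=|] := boolP (x \in _).
      rewrite in_itv/= andbT mulr1 => tx; apply: expR_le_quad.
      by rewrite mulNr lerNl mulrC -ler_pdivrMr// mulN1r.
    rewrite mulr0; nra.
  by rewrite integral0 adde0 sqrrN.
have E0 : 0 <= \int[P]_w (f (Z w))%:E by apply: integral_ge0 => w _; rewrite lee_fin.
have fin : \int[P]_w (f (Z w))%:E \is a fin_num.
  by rewrite ge0_fin_numE// (le_lt_trans fe)// ltry.
pose r := fine (\int[P]_w (f (Z w))%:E).
have rE : \int[P]_w (f (Z w))%:E = r%:E by rewrite fineK.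
have r0 : (0 <= r)%R by rewrite -lee_fin -rE.
have re : (r <= 1 + 2 * t ^+ 2 * v)%R by rewrite -lee_fin -rE.
pose A x : R := \1_(`[a, +oo[%classic) x.
have A0 x : (0 <= A x)%R by rewrite /A.
have mA : measurable_fun setT A by exact: measurable_indic.
have PA : \int[P]_w (A (Z w))%:E = P [set w | (a <= Z w)%R] by exact: integral_indic_ge.
have Pfin : P [set w | (a <= Z w)%R] \is a fin_num.
  by rewrite fin_num_measure//; exact: measurable_RV_ge.
pose p := fine (P [set w | (a <= Z w)%R]).
have pE : P [set w | (a <= Z w)%R] = p%:E by rewrite fineK.
have p0 : (0 <= p)%R by rewrite -lee_fin -pE.
(* The products over [j] encode the two bad cases: the jump indicator times [X i ^+ 2] for [g1 i],
   the jump indicator times the truncated exponentials of all other summands for [g2]. *)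
pose g1 i j : R -> R := if j == i0 then A else if j == i then fun x => (x ^+ 2)%R else cst 1%R.
pose g2 j : R -> R := if j == i0 then A else f.
have mg1 i j : measurable_fun setT (g1 i j).
  by rewrite /g1; case: ifP => // _; case: ifP => // _; exact: measurable_funX.
have g10 i j x : (0 <= g1 i j x)%R.
  by rewrite /g1; case: ifP => // _; case: ifP => // _; exact: sqr_ge0.
have mg2 j : measurable_fun setT (g2 j) by rewrite /g2; case: ifP.
have g20 j x : (0 <= g2 j x)%R by rewrite /g2; case: ifP.
have Ig1 i : i != i0 -> \int[P]_w (\prod_j g1 i j (X j w))%:E = (p * v)%:E.
  move=> ii0.
  rewrite (iid_integral_prod (e := fun j => if j == i0 then p else if j == i then v else 1%R))//.
    rewrite (bigD1 i0)//= eqxx (bigD1 i)//= (negbTE ii0) eqxx big1 ?mulr1//.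
    by move=> j /andP[/negbTE -> /negbTE ->].
  move=> j; rewrite /g1; case: ifP => _; first by rewrite PA.
  case: ifP => _ //; rewrite /= integral_cst//.
  by rewrite [X in 1 * X](_ : _ = 1) ?mule1//; exact: probability_setT.
have Ig2 : \int[P]_w (\prod_j g2 j (X j w))%:E = (p * \prod_(j | j != i0) r)%:E.
  rewrite (iid_integral_prod (e := fun j => if j == i0 then p else r))//.
    rewrite (bigD1 i0)//= eqxx; congr (_ * _)%:E.
    by apply: eq_bigr => j /negbTE ->.
  by move=> j; rewrite /g2; case: ifP => _; rewrite ?PA.
have mS : measurable [set w | (a - c <= \sum_i X i w)%R] by exact: measurable_iid_sum_ge.
have m1 : measurable_fun setT (fun w => (\1_[set w | (a - c <= \sum_i X i w)%R] w)%:E : \bar R).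
  by apply/measurable_EFinP; exact: measurable_indic.
have mp (g : I -> R -> R) : (forall j, measurable_fun setT (g j)) ->
    measurable_fun setT (fun w => (\prod_j g j (X j w))%:E).
  move=> mg.
  by apply/measurable_EFinP; apply: measurable_prod => i _; exact: measurableT_comp.
have msum : measurable_fun setT (fun w =>
    \sum_(i | i != i0) (t ^+ 2)%:E * (\prod_j g1 i j (X j w))%:E).
  under eq_fun do rewrite -big_filter.
  by apply: emeasurable_sum => i; apply: measurable_funeM; exact: mp.
rewrite -[in leLHS]PA -(identically_distributed_integral (distrX i0))//.
apply: (@le_trans _ _ (\int[P]_w ((\1_[set w | (a - c <= \sum_i X i w)%R] w)%:E +
   (\sum_(i | i != i0) (t ^+ 2)%:E * (\prod_j g1 i j (X j w))%:E +
    (expR (- (t * c)))%:E * (\prod_j g2 j (X j w))%:E)))).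
  apply: ge0_le_integral => //.
  - by move=> w _; rewrite lee_fin.
  - exact: mcomp.
  - apply: emeasurable_funD => //; apply: emeasurable_funD => //.
    by apply: measurable_funeM; exact: mp.
  move=> w _.
  rewrite (eq_bigr (fun i => (t ^+ 2 * \prod_j g1 i j (X j w))%:E)); last by [].
  rewrite sumEFin -EFinM -!EFinD lee_fin.
  have p1 i : (0 <= \prod_j g1 i j (X j w))%R by apply: prodr_ge0.
  have p2 : (0 <= \prod_j g2 j (X j w))%R by apply: prodr_ge0.
  have p2' : (0 <= expR (- (t * c)) * \prod_j g2 j (X j w))%R.
    by rewrite mulr_ge0// expR_ge0.
  have s0 : (0 <= \sum_(i | i != i0) t ^+ 2 * \prod_j g1 i j (X j w))%R.
    by apply: sumr_ge0 => i _; rewrite mulr_ge0// sqr_ge0.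
  have [aX|aX] := leP a (X i0 w); last first.
    by rewrite {1}/A indicE memNset ?addr_ge0//= in_itv/= andbT leNgt aX.
  have Aw : A (X i0 w) = 1%R by rewrite /A indicE mem_set//= in_itv/= aX.
  rewrite Aw indicE.
  have [|wS] := boolP (w \in _); first by rewrite lerDl addr_ge0.
  rewrite add0r.
  (* In the first case [t * X i w < -1], so the term of index [i] alone is at least 1. *)
  have [[i [ii0 bi]]|/forallNP h] := pselect (exists i, i != i0 /\ (X i w < - t^-1)%R).
    apply: (@le_trans _ _ (\sum_(i | i != i0) t ^+ 2 * \prod_j g1 i j (X j w))%R);
      last by rewrite lerDl.
    rewrite (bigD1 i)//= -[leLHS]addr0 lerD//; last first.
      by apply: sumr_ge0 => j _; rewrite mulr_ge0// sqr_ge0.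
    rewrite (bigD1 i0)//= (bigD1 i)//= big1 => [|j /andP[/negbTE ji0 /negbTE ji]]; last first.
      by rewrite /g1 ji0 ji.
    rewrite /g1 eqxx (negbTE ii0) eqxx Aw mul1r mulr1 -exprMn.
    have : (t * X i w < -1)%R.
      by rewrite mulrC -ltr_pdivlMr// mulN1r.
    nra.
  apply: (@le_trans _ _ (expR (- (t * c)) * \prod_j g2 j (X j w))%R); last by rewrite lerDr.
  rewrite (bigD1 i0)//= {1}/g2 eqxx Aw mul1r.
  rewrite (eq_bigr (fun i => expR (- t * X i w))) => [|i ii0]; last first.
    rewrite /g2 (negbTE ii0) /f indicE mem_set ?mulr1//= in_itv/= andbT leNgt.
    by apply/negP => ?; apply: (h i).
  rewrite -expR_sum -expRD -mulr_sumr -expR0 ler_expR mulNr -opprD -mulrDr oppr_ge0.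
  rewrite pmulr_rle0//.
  move: wS; rewrite notin_setE/= => /negP; rewrite -ltNge (bigD1 i0)//=.
  by lra.
rewrite ge0_integralD//; first last.
- apply: emeasurable_funD => //.
  by apply: measurable_funeM; exact: mp.
- move=> w _; rewrite adde_ge0//.
    by apply: sume_ge0 => i _; rewrite -EFinM lee_fin mulr_ge0 ?sqr_ge0 ?prodr_ge0.
  by rewrite -EFinM lee_fin mulr_ge0 ?expR_ge0 ?prodr_ge0.
rewrite integral_indic// setIT leeD2l// ge0_integralD//; first last.
- by apply: measurable_funeM; exact: mp.
- by move=> w _; rewrite -EFinM lee_fin mulr_ge0 ?expR_ge0 ?prodr_ge0.
- by move=> w _; apply: sume_ge0 => i _; rewrite -EFinM lee_fin mulr_ge0 ?sqr_ge0 ?prodr_ge0.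
under eq_integral do rewrite -big_filter.
rewrite ge0_integral_sum//; first last.
- by move=> i w _; rewrite -EFinM lee_fin mulr_ge0 ?sqr_ge0 ?prodr_ge0.
- by move=> i; apply: measurable_funeM; exact: mp.
rewrite big_filter (eq_bigr (fun=> (t ^+ 2 * (p * v))%:E)) => [|i ii0]; last first.
  rewrite ge0_integralZl ?Ig1//.
  - exact: mp.
  - by move=> w _; rewrite lee_fin prodr_ge0.
  - by rewrite lee_fin sqr_ge0.
rewrite ge0_integralZl//; first last.
- by move=> w _; rewrite lee_fin prodr_ge0.
- exact: mp.
rewrite Ig2 sumEFin -EFinM -EFinD pE -EFinM lee_fin mulrDr.
have cI : (#|[pred i | i != i0]| <= #|I|)%N by exact: max_card.
have s1 : (1 <= 1 + 2 * t ^+ 2 * v)%R by rewrite lerDl mulr_ge0// mulr_ge0 ?sqr_ge0.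
apply: lerD.
  rewrite sumr_const -[leLHS]mulr_natl.
  rewrite mulrA mulrCA ler_wpM2l// ler_wpM2r// ler_wpM2r ?sqr_ge0// ler_nat.
  exact: cI.
rewrite prodr_const mulrCA ler_wpM2l// ler_wpM2l ?expR_ge0//.
rewrite (@le_trans _ _ ((1 + 2 * t ^+ 2 * v) ^+ #|[pred i | i != i0]|)%R)//.
  by rewrite lerXn2r// nnegrE (le_trans r0).
by rewrite ler_weXn2l.
Qed.

End iid_sum.

(** The [k]-th piece carries the weight [expR k.+2%:R] against a tail of order [expR (- k.+1%:R)];
    their quotient is the factor [expR 1], and [D] is the gain left over. *)
Lemma truncated_mgf_le d (T : measurableType d) (R : realType)
    (P : probability T R) (Z : {RV P >-> R}) (t b v D : R) (K : nat) :
    0 < t -> t * b <= K.+1%:R -> centered Z ->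
    (\int[P]_w (Z w ^+ 2)%:E = v%:E)%E ->
    (forall k, (k < K)%N ->
      (P [set w | k.+1%:R / t <= Z w]%R <= (expR (- k.+1%:R) * D)%:E)%E) ->
  (\int[P]_w (expR (t * Z w) * \1_(`]-oo, b[%classic) (Z w))%:E <=
    (1 + 2 * t ^+ 2 * v + K%:R * (expR 1 * D))%:E)%E.
Proof.
move=> t0 tb cZ sq PD.
pose f (x : R) : R := expR (t * x) * \1_(`]-oo, b[%classic) x.
have mf : measurable_fun setT f.
  by apply: measurable_funM => //; apply: measurableT_comp => //; exact: measurable_funM.
have f0 x : 0 <= f x by rewrite mulr_ge0// expR_ge0.
pose gk (k : nat) (x : R) : R := expR k.+2%:R * \1_(`[k.+1%:R / t, +oo[%classic) x.
have gk0 k x : 0 <= gk k x by rewrite mulr_ge0// expR_ge0.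
have mgk k : measurable_fun setT (gk k).
  by apply: measurable_funM => //.
pose g (x : R) : R := \sum_(k < K) gk k x.
have g0 x : 0 <= g x by apply: sumr_ge0.
have mg : measurable_fun setT g by apply: measurable_sum => k.
apply: (le_trans (integral_le_quad (t := t) (g := g) cZ sq mf f0 mg g0 _)).
  move=> x; have [xb|xb] := ltP x b; last first.
    rewrite {1}/f indicE memNset/= ?in_itv/= ?ltNge ?xb// mulr0.
    by rewrite addr_ge0//; nra.
  rewrite {1}/f indicE mem_set ?in_itv//= mulr1.
  have -> : g x = \sum_(k < K) expR k.+2%:R * \1_(`[k.+1%:R, +oo[%classic) (t * x).
    apply: eq_bigr => k _; rewrite /gk !indicE; congr (_ * _%:R); congr nat_of_bool.
    by apply/idP/idP; rewrite !inE/= !in_itv/= !andbT ler_pdivrMr// mulrC.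
  by apply: expR_le_quad_sum; rewrite (lt_le_trans _ tb)// ltr_pM2l.
rewrite [leRHS]EFinD leeD2l//.
under eq_integral do rewrite /g -sumEFin.
have mgkZ (k : nat) : measurable_fun setT (fun w => (gk k (Z w))%:E).
  by apply/measurable_EFinP; exact: measurableT_comp.
rewrite ge0_integral_sum//; last by move=> k w _; rewrite lee_fin.
apply: (@le_trans _ _ (\sum_(k < K) (expR 1 * D)%:E)%E); last first.
  by rewrite sumEFin sumr_const card_ord mulr_natl.
apply: lee_sum => k _.
under eq_integral do rewrite EFinM.
rewrite ge0_integralZl ?lee_fin ?expR_ge0//; last first.
  by apply/measurable_EFinP; exact: measurableT_comp.
rewrite integral_indic_ge.
apply: (le_trans (lee_pmul _ _ (lexx _) (PD k (ltn_ord k)))) => //.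
rewrite -EFinM lee_fin mulrA -expRD.
by rewrite (_ : k.+2%:R - k.+1%:R = 1)// -[in k.+2]addn1 natrD; ring.
Qed.

(** * Asymptotic relations as eventual inequalities *)

Section asymptotics.
Context (R : realType).
Implicit Types (x y M : nat -> R) (a : nat -> \bar R).

Lemma asymp_le_near x y (A : R) :
  (\forall n \near \oo, `|x n / y n| <= A) -> asymp_le x y.
Proof.
move=> [m _ xyA]; rewrite /asymp_le.
apply: (@le_lt_trans _ _ A%:E); last exact: ltry.
rewrite /limn_esup limf_esupE; apply: ge_ereal_inf.
exists (ereal_sup [set `|x n / y n|%:E | n in [set n | (m <= n)%N]]).
  by exists [set n | (m <= n)%N] => //; exists m.
by apply: ge_ereal_sup => _ [n mn <-]; rewrite lee_fin; exact: xyA.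
Qed.

(** The ratio is eventually finite, which excludes infinite values of [a n]; as [y n] is negative,
    clearing the denominator reverses the inequalities. *)
Lemma asymp_equiv_near a y (z : R) : asymp_equiv a y ->
    (\forall n \near \oo, y n < 0) -> 0 < z ->
  \forall n \near \oo,
    (((1 + z) * y n)%:E <= a n)%E /\ (a n <= ((1 - z) * y n)%:E)%E.
Proof.
move=> /fine_cvgP[afin /cvgrPdist_le/(_ z)h] yneg z0.
near=> n.
have yn : y n < 0 by near: n.
have : (a n * (y n)^-1%:E)%E \is a fin_num by near: n.
have : `|1 - fine (a n * (y n)^-1%:E)| <= z by near: n; exact: h.
have yi : (y n)^-1 < 0 by rewrite invr_lt0.
case: (a n) => [r| |] /=.
- move=> + _; rewrite ler_distlC => /andP[h1 h2]; rewrite !lee_fin.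
  by move: h1 h2; rewrite ler_ndivlMr// ler_ndivrMr.
- by rewrite lt0_mulye ?lte_fin.
- by rewrite lt0_mulNye ?lte_fin.
Unshelve. all: by end_near. Qed.

Lemma little_o_near a y (z : R) : little_o a y ->
    (\forall n \near \oo, 0 < y n) -> 0 < z ->
  \forall n \near \oo, a n \is a fin_num /\ fine (a n) <= z * y n.
Proof.
move=> /fine_cvgP[afin /cvgrPdist_le/(_ z)h] ypos z0.
near=> n.
have yn : 0 < y n by near: n.
have : (a n * (y n)^-1%:E)%E \is a fin_num by near: n.
have : `|0 - fine (a n * (y n)^-1%:E)| <= z by near: n; exact: h.
have yi : 0 < (y n)^-1 by rewrite invr_gt0.
case: (a n) => [r| |] /=.
- move=> + _; rewrite sub0r normrN => h1; split=> //.
  by rewrite -ler_pdivrMr// (le_trans (ler_norm _)).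
- by rewrite gt0_mulye ?lte_fin.
- by rewrite gt0_mulNye ?lte_fin.
Unshelve. all: by end_near. Qed.

Lemma near_powR_ge M (s A : R) : M @ \oo --> +oo%R -> 0 < s ->
  \forall n \near \oo, A <= M n `^ s.
Proof.
move=> /cvgryPge Moo s0.
near=> n.
pose B := Num.max A 0.
have B0 : 0 <= B by rewrite /B le_max lexx orbT.
have MB : B `^ s^-1 <= M n by near: n; exact: Moo.
rewrite (@le_trans _ _ B)// ?le_max ?lexx//.
rewrite -{1}(powRr1 B0) -[1](mulVf (lt0r_neq0 s0)) powRrM.
have M0 : 0 <= M n by rewrite (le_trans _ MB)// powR_ge0.
by apply: ge0_ler_powR => //; rewrite ?nnegrE ?powR_ge0// ltW.
Unshelve. all: by end_near. Qed.

(** The logarithm of half the power is at most that half power; the other half power, which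
    diverges, absorbs the constants. *)
Lemma near_ln_le M (s z : R) : M @ \oo --> +oo%R -> 0 < s -> 0 < z ->
  \forall n \near \oo, ln (M n) <= z * M n `^ s.
Proof.
move=> Moo s0 z0.
near=> n.
have M1 : 1 <= M n by near: n; move/cvgryPge : Moo; apply.
have M0 : 0 < M n by rewrite (lt_le_trans ltr01).
have MA : 2 / (s * z) <= M n `^ (s / 2).
  by near: n; apply: near_powR_ge => //; rewrite divr_gt0.
have h : ln (M n `^ (s / 2)) <= M n `^ (s / 2).
  by rewrite ltW// ln_sublinear// powR_gt0.
move: h; rewrite ln_powR.
have -> : M n `^ s = M n `^ (s / 2) * M n `^ (s / 2).
  by rewrite -powRD ?(gt_eqF M0) ?implybT// -splitr.
move: MA; rewrite ler_pdivrMr ?mulr_gt0//.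
have := powR_gt0 (s / 2) M0.
set Q := M n `^ (s / 2); move=> Q0 h1 h2.
have : 2 * Q <= Q * (s * z) * Q by rewrite ler_pM2r.
move=> h3; rewrite -(ler_pM2l s0); nra.
Unshelve. all: by end_near. Qed.
End asymptotics.

(** * The truncated Chernoff bound in exponential form *)

(** Combines the two preceding bounds, using [1 + s <= expR s] to turn the power of the truncated
    moment into an additive term of the exponent. *)
Lemma iid_sum_ge_le_tail d (T : measurableType d) (R : realType)
    (P : probability T R) (I : finType) (X : I -> {RV P >-> R})
    (Z : {RV P >-> R}) (t b v D p : R) (K : nat) :
    mutually_independent X -> (forall i, identically_distributed (X i) Z) ->
    0 < t -> t * b <= K.+1%:R -> centered Z ->
    (\int[P]_w (Z w ^+ 2)%:E = v%:E)%E ->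
    (forall k, (k < K)%N ->
      (P [set w | k.+1%:R / t <= Z w]%R <= (expR (- k.+1%:R) * D)%:E)%E) ->
    0 <= D -> (P [set w | b <= Z w]%R <= p%:E)%E ->
  (P [set w | b <= \sum_i X i w]%R <=
    (#|I|%:R * p +
     expR (- (t * b) + #|I|%:R * (2 * t ^+ 2 * v + K%:R * (expR 1 * D))))%:E)%E.
Proof.
move=> indep distr t0 tb cZ sq PD D0 Pp.
have h := truncated_mgf_le t0 tb cZ sq PD.
have v0 : 0 <= v.
  by rewrite -lee_fin -sq; apply: integral_ge0 => w _; rewrite lee_fin sqr_ge0.
set s := 2 * t ^+ 2 * v + K%:R * (expR 1 * D).
have s0 : 0 <= s.
  apply: addr_ge0; first by rewrite mulr_ge0// mulr_ge0 ?sqr_ge0.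
  by rewrite mulr_ge0// mulr_ge0 ?expR_ge0.
apply: (le_trans (iid_sum_ge_le indep distr (ltW t0) h)).
rewrite EFinD leeD//.
  by rewrite EFinM lee_pmul// lee_fin.
rewrite lee_fin expRD ler_wpM2l ?expR_ge0// -addrA -/s expRM_natl lerXn2r ?expR_ge1Dx//.
- by rewrite nnegrE addr_ge0.
- by rewrite nnegrE expR_ge0.
Qed.

Lemma lne_le_EFin (R : realType) (x : \bar R) (r : R) : (0 <= x)%E ->
  (lne x <= r%:E)%E = (x <= (expR r)%:E)%E.
Proof. by move=> x0; rewrite -lee_expeR lneK// in_itv/= x0 leey. Qed.

Lemma EFin_le_lne (R : realType) (x : \bar R) (r : R) : (0 <= x)%E ->
  (r%:E <= lne x)%E = ((expR r)%:E <= x)%E.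
Proof. by move=> x0; rewrite -lee_expeR lneK// in_itv/= x0 leey. Qed.

(** * Asymptotic bounds under the tail hypothesis *)

Section weibull_tail.
Context (R : realType) (d : measure_display)
    (Omega : measurableType d) (P : probability Omega R)
    (N : nat -> nat) (Y : nat -> {RV P >-> R}) (eps q alpha : R).
Hypothesis Ngt0 : forall n : nat, (1 <= n)%N -> (1 <= N n)%N.
Hypothesis eps01 : 0 < eps < 1.
Hypothesis q_gt0 : 0 < q.
Hypothesis alpha_gt0 : 0 < alpha.
Hypothesis tail : forall y : nat -> R,
      (forall n : nat, (1 <= n)%N -> 0 < y n) ->
      asymp_le (fun n => (N n)%:R `^ (alpha * eps)) y ->
      asymp_le y (fun n => (N n)%:R `^ alpha) ->
      asymp_equiv (fun n => lne (P [set w | y n <= Y n w]))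
                  (fun n => - q * y n `^ (1 - eps)).

Let M n : R := (N n)%:R.

Let M1 n : (1 <= n)%N -> 1 <= M n.
Proof. by move=> /Ngt0; rewrite /M ler1n. Qed.

(** Uniformity in [u] is needed because the upper bound uses a number of thresholds that grows with
    [n]. The constants [c] and [C] are free because [asymp_le] only bounds ratios. *)
Lemma tail_near (c C z : R) : 0 < c -> 0 < C -> 0 < z ->
  \forall n \near \oo, forall u,
    c * M n `^ (alpha * eps) <= u <= C * M n `^ alpha ->
    (((1 + z) * (- q * u `^ (1 - eps)))%:E <= lne (P [set w | u <= Y n w]%R))%E /\
    (lne (P [set w | u <= Y n w]%R) <= ((1 - z) * (- q * u `^ (1 - eps)))%:E)%E.
Proof.
move=> c0 C0 z0.
pose good n u := (((1 + z) * (- q * u `^ (1 - eps)))%:E <= lne (P [set w | u <= Y n w]%R))%E /\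
    (lne (P [set w | u <= Y n w]%R) <= ((1 - z) * (- q * u `^ (1 - eps)))%:E)%E.
pose rng n u := c * M n `^ (alpha * eps) <= u <= C * M n `^ alpha.
(* [y n] is a counterexample to the claim for [n], if there is one *)
have /choice[y yP] : forall n, exists u,
    (rng n u \/ u = M n `^ alpha) /\ (good n u -> forall u, rng n u -> good n u).
  move=> n; have [[u [ru gu]]|/forallNP h] := pselect (exists u, rng n u /\ ~ good n u).
    by exists u; split => //; left.
  (* The default value keeps the sequence admissible for the tail hypothesis at indices without a
     counterexample. *)
  exists (M n `^ alpha); split; [by right|move=> _ u ru].
  by apply: contrapT => gu; apply: (h u).
have ypos n : (1 <= n)%N -> 0 < y n.
  move=> /M1 m1; have m0 : 0 < M n by rewrite (lt_le_trans ltr01).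
  have [[/andP[h _]|->] _] := yP n; last exact: powR_gt0.
  by apply: lt_le_trans h; rewrite mulr_gt0// powR_gt0.
have aea : alpha * eps <= alpha.
  by have /andP[_ e1] := eps01; rewrite ger_pMr// ltW.
have y1 : asymp_le (fun n => M n `^ (alpha * eps)) y.
  apply: (@asymp_le_near _ _ _ (Num.max c^-1 1)); near=> n.
  have n1 : (1 <= n)%N by near: n; exists 1%N.
  have m1 := M1 n1; have y0 := ypos _ n1.
  rewrite ger0_norm; last by rewrite divr_ge0 ?powR_ge0// ltW.
  rewrite ler_pdivrMr//.
  have [[/andP[h _]|->] _] := yP n.
    rewrite (@le_trans _ _ (c^-1 * y n))//; last first.
      by apply: ler_wpM2r; [exact: ltW|rewrite le_max lexx].
    by rewrite ler_pdivlMl.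
  rewrite (le_trans (ler_powR m1 aea))// ler_peMl ?powR_ge0//.
  by rewrite le_max lexx orbT.
have y2 : asymp_le y (fun n => M n `^ alpha).
  apply: (@asymp_le_near _ _ _ (Num.max C 1)); near=> n.
  have n1 : (1 <= n)%N by near: n; exists 1%N.
  have m1 := M1 n1; have y0 := ypos _ n1.
  have m0 : 0 < M n by rewrite (lt_le_trans ltr01).
  rewrite ger0_norm; last by rewrite divr_ge0 ?powR_ge0// ltW.
  rewrite ler_pdivrMr ?powR_gt0//.
  have [[/andP[_ h]|->] _] := yP n.
    by rewrite (le_trans h)// ler_wpM2r ?powR_ge0// le_max lexx.
  by rewrite ler_peMl ?powR_ge0// le_max lexx orbT.
have yneg : \forall n \near \oo, - q * y n `^ (1 - eps) < 0.
  near=> n; have n1 : (1 <= n)%N by near: n; exists 1%N.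
  by rewrite mulNr oppr_lt0 mulr_gt0// powR_gt0// ypos.
have h := asymp_equiv_near (tail ypos y1 y2) yneg z0.
near=> n; have [_] := yP n; apply.
by near: n; exact: h.
Unshelve. all: by end_near. Qed.

Context (Yi : forall n : nat, 'I_(N n) -> {RV P >-> R}).
Hypothesis Noo : N @ \oo --> \oo.
Hypothesis Ycentered : forall n : nat, (1 <= n)%N -> centered (Y n).
Hypothesis Yi_indep : forall n : nat, (1 <= n)%N -> mutually_independent (@Yi n).
Hypothesis Yi_distr : forall n : nat, (1 <= n)%N ->
      forall i : 'I_(N n), identically_distributed (@Yi n i) (Y n).
Hypothesis second_moment :
      little_o (fun n => 'E_P[fun w => (Y n w ^+ 2)%R]%E)
                     (fun n => (N n)%:R `^ (alpha * (1 + eps) - 1)).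

Let L n : R := M n `^ (alpha * (1 - eps)).

Let Moo : M @ \oo --> +oo.
Proof. by apply/cvgrnyP. Qed.

Let theta0 : 0 < alpha * (1 - eps).
Proof. by rewrite mulr_gt0// subr_gt0; case/andP: eps01. Qed.

Lemma second_moment_near (z : R) : 0 < z -> \forall n \near \oo, exists2 v,
  (\int[P]_w (Y n w ^+ 2)%:E = v%:E)%E & 0 <= v <= z * M n `^ (alpha * (1 + eps) - 1).
Proof.
move=> z0.
have Mpos : \forall n \near \oo, 0 < M n `^ (alpha * (1 + eps) - 1).
  near=> n; have n1 : (1 <= n)%N by near: n; exists 1%N.
  by rewrite powR_gt0// (lt_le_trans ltr01)// M1.
have h := little_o_near second_moment Mpos z0.
near=> n.
have [] : 'E_P[fun w => (Y n w ^+ 2)%R]%E \is a fin_num /\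
   fine ('E_P[fun w => (Y n w ^+ 2)%R]%E) <= z * M n `^ (alpha * (1 + eps) - 1).
  by near: n; exact: h.
rewrite unlock => f1 f2.
exists (fine (\int[P]_w (Y n w ^+ 2)%:E)); first by rewrite fineK.
rewrite f2 andbT fine_ge0//.
by apply: integral_ge0 => w _; rewrite lee_fin sqr_ge0.
Unshelve. all: by end_near. Qed.

Let PfinS n (b : R) : P [set w | b <= \sum_(i < N n) @Yi n i w]%R \is a fin_num.
Proof. by rewrite fin_num_measure//; exact: measurable_iid_sum_ge. Qed.

(** The allowance [eta] is split: a quarter for a jump slightly larger than needed, a quarter for
    the error in the tail hypothesis, and the rest for a constant factor 2. *)
Lemma sum_tail_ge (y eta : R) : 0 <= y -> 0 < eta -> \forall n \near \oo,
  ((expR (- ((q * y `^ (1 - eps) + eta) * L n)))%:E <=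
    P [set w | M n `^ alpha * y <= \sum_(i < N n) @Yi n i w]%R)%E.
Proof.
move=> y0 eta0; have /andP[e0 e1] := eps01.
have e1' : 0 < 1 - eps by rewrite subr_gt0.
(* The jump size [x], in units of [M n ^ alpha], is defined through its rate, so that [q * A]
   exceeds the target by exactly [eta / 4]; this gives [y < x] even when [y] is 0. *)
pose tau := eta / (4 * q).
have tau0 : 0 < tau by rewrite divr_gt0// mulr_gt0.
pose A := y `^ (1 - eps) + tau.
have A0 : 0 < A by rewrite ltr_wpDl// powR_ge0.
pose x := A `^ (1 - eps)^-1.
have x0 : 0 < x by exact: powR_gt0.
have xA : x `^ (1 - eps) = A.
  by rewrite /x -powRrM mulVf ?gt_eqF// powRr1// ltW.
have yx : y < x.
  rewrite ltNge; apply/negP => xy.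
  have : x `^ (1 - eps) <= y `^ (1 - eps).
    by apply: ge0_ler_powR; rewrite ?nnegrE ?(ltW e1')// ltW.
  by rewrite xA /A; lra.
pose z := eta / (4 * q * A).
have z0 : 0 < z by rewrite divr_gt0// !mulr_gt0.
pose del := x - y.
have del0 : 0 < del by rewrite subr_gt0.
have tn := tail_near x0 x0 z0.
(* With [t = 4 / (del * B)], the constant 128 makes the Chebyshev term at most
   [16 / 128 = 1 / 8]. *)
have sm := @second_moment_near (del ^+ 2 / 128) (divr_gt0 (exprn_gt0 2 del0) (ltr0n _ 128)).
have Lbig := near_powR_ge (2 / eta) Moo theta0.
near=> n.
have n1 : (1 <= n)%N by near: n; exists 1%N.
have m1 : 1 <= M n := M1 n1.
have m0 : 0 < M n by rewrite (lt_le_trans ltr01).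
have [v sq /andP[v0 vle]] : exists2 v,
  (\int[P]_w (Y n w ^+ 2)%:E = v%:E)%E &
  0 <= v <= del ^+ 2 / 128 * M n `^ (alpha * (1 + eps) - 1) by near: n; exact: sm.
have L2 : 2 / eta <= L n by near: n; exact: Lbig.
have tu : forall u, x * M n `^ (alpha * eps) <= u <= x * M n `^ alpha ->
    (((1 + z) * (- q * u `^ (1 - eps)))%:E <= lne (P [set w | u <= Y n w]%R))%E /\
    (lne (P [set w | u <= Y n w]%R) <= ((1 - z) * (- q * u `^ (1 - eps)))%:E)%E.
  by near: n; exact: tn.
set B := M n `^ alpha in tu *.
have B0 : 0 < B by exact: powR_gt0.
have Be : M n `^ (alpha * eps) <= B by apply: ler_powR => //; rewrite ger_pMr// ltW.
have /tu[+ _] : x * M n `^ (alpha * eps) <= x * B <= x * B by rewrite lexx andbT ler_pM2l.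
have -> : (x * B) `^ (1 - eps) = A * L n.
  by rewrite powRM ?(ltW x0) ?(ltW B0)// xA /B -powRrM.
rewrite EFin_le_lne//.
have i0 : 'I_(N n) by case: (N n) (Ngt0 n1) => // k _; exact: ord0.
pose c := del * B; have c0 : 0 < c by exact: mulr_gt0.
pose t := 4 / c; have t0 : 0 < t by exact: divr_gt0.
have := iid_sum_ge_ge (Yi_indep n1) (Yi_distr n1) i0 (x * B) c t0 (Ycentered n1) sq.
have -> : x * B - c = B * y by rewrite /c /del; ring.
set S := [set w | B * y <= _].
have mY : measurable [set w | x * B <= Y n w] by exact: measurable_RV_ge.
rewrite -(fineK (PfinS n (B * y))) -/S -(fineK (fin_num_measure P _ mY)).
set p := fine (P [set w | _]); set pS := fine (P S).
rewrite card_ord -EFinM -EFinD !lee_fin => h1 h2.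
have s8 : (N n)%:R * t ^+ 2 * v <= 1 / 8.
  have mm : M n * M n `^ (alpha * (1 + eps) - 1) <= B * B.
    rewrite mulr_powRB1// ?(ltW m0)//; last by rewrite mulr_gt0// addr_gt0.
    rewrite mulrDr mulr1 powRD ?(gt_eqF m0) ?implybT//.
    by rewrite ler_wpM2l// ltW.
  have -> : t ^+ 2 = 16 / (del ^+ 2 * (B * B)).
    by rewrite /t /c; field; rewrite ?gt_eqF.
  have d2 : 0 < del ^+ 2 by exact: exprn_gt0.
  have BB : 0 < B * B by exact: mulr_gt0.
  rewrite (_ : _ * v = M n * v * 16 / (del ^+ 2 * (B * B))); last by rewrite /M; ring.
  rewrite ler_pdivrMr ?mulr_gt0//.
  have : M n * v <= del ^+ 2 / 128 * (B * B).
    rewrite (le_trans (ler_wpM2l (ltW m0) vle))// mulrCA ler_wpM2l// ltW//.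
    exact: divr_gt0.
  lra.
have tc : t * c = 4 by rewrite /t divfK// gt_eqF.
(* The exponent is at most [- 4 + 2 / 8], hence below [- 3]. *)
have e4 : expR (- (t * c)) * (1 + 2 * t ^+ 2 * v) ^+ (N n) <= 1 / 4.
  have u0 : 0 <= 2 * t ^+ 2 * v by rewrite mulr_ge0// mulr_ge0 ?sqr_ge0.
  have : (1 + 2 * t ^+ 2 * v) ^+ (N n) <= expR ((N n)%:R * (2 * t ^+ 2 * v)).
    rewrite expRM_natl lerXn2r ?expR_ge1Dx// nnegrE ?expR_ge0//.
    by rewrite addr_ge0.
  move=> /(ler_wpM2l (expR_ge0 (- (t * c)))); rewrite -expRD tc => /le_trans; apply.
  apply: (@le_trans _ _ (expR (- 3))); first by rewrite ler_expR; nra.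
  rewrite expRN div1r lef_pV2 ?posrE ?expR_gt0//.
  by apply: le_trans (expR_ge1Dx 3); lra.
have p0 : 0 <= p by rewrite (le_trans (expR_ge0 _) h2).
have pS2 : p <= 2 * pS by nra.
(* The extra 1 is affordable since [eta / 2 * L n >= 1]; it yields a factor [expR 1 >= 2] that
   compensates [p <= 2 * pS]. *)
have : expR (- ((q * y `^ (1 - eps) + eta) * L n) + 1) <= p.
  apply: le_trans h2; rewrite ler_expR.
  have -> : (1 + z) * (- q * (A * L n)) = - ((q * A + z * q * A) * L n) by ring.
  have -> : z * q * A = eta / 4 by rewrite /z; field; rewrite ?gt_eqF.
  have -> : q * A = q * y `^ (1 - eps) + eta / 4.
    by rewrite /A mulrDr; congr (_ + _); rewrite /tau; field; rewrite ?gt_eqF.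
  move: L2; rewrite ler_pdivrMr//; lra.
rewrite expRD => h3.
have := expR_ge1Dx (1 : R); have := expR_gt0 (- ((q * y `^ (1 - eps) + eta) * L n)).
nra.
Unshelve. all: by end_near. Qed.

(** Of [eta], one half covers the drop from [q] to [q1], a quarter covers the factor [M n] or the
    exponential moment, and an eighth covers adding the two contributions. *)
Lemma sum_tail_le (y eta : R) : 0 < y -> 0 < eta -> \forall n \near \oo,
  (P [set w | M n `^ alpha * y <= \sum_(i < N n) @Yi n i w]%R <=
    (expR (- ((q * y `^ (1 - eps) - eta) * L n)))%:E)%E.
Proof.
move=> y0 eta0; have /andP[e0 e1] := eps01.
have e1' : 0 < 1 - eps by rewrite subr_gt0.
pose A := y `^ (1 - eps); have A0 : 0 < A by exact: powR_gt0.
pose z := Num.min (1 / 4) (eta / (4 * q * A)).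
have z0 : 0 < z by rewrite lt_min divr_gt0//= divr_gt0// !mulr_gt0.
have z4 : z <= 1 / 4 by rewrite ge_min lexx.
have zeta : z * q * A <= eta / 4.
  have : z <= eta / (4 * q * A) by rewrite ge_min lexx orbT.
  rewrite ler_pdivlMr ?mulr_gt0//; lra.
(* the rate obtained is [q1]; the gap to [q2] absorbs
   the number of pieces in the truncated exponential moment *)
pose q1 := (1 - 2 * z) * q; pose q2 := (1 - z) * q.
have q12 : q1 < q2 by rewrite ltr_pM2r//; lra.
have q10 : 0 < q1 by rewrite mulr_gt0//; lra.
(* [kap] is the Chernoff parameter [t] in units of [M n ^ (- alpha * eps)]; [rho] is chosen so that
   [(q2 - q1) * u ^ (1 - eps)] is at least [rho * M n ^ th] as soon as [u >= t^-1]. *)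
pose kap := q1 * y `^ (- eps).
have kap0 : 0 < kap by rewrite mulr_gt0// powR_gt0.
have kapi0 : 0 < kap^-1 by rewrite invr_gt0.
pose rho := (q2 - q1) * (kap^-1) `^ (1 - eps).
have rho0 : 0 < rho.
  by rewrite mulr_gt0 ?powR_gt0// subr_gt0.
pose th := alpha * eps * (1 - eps).
have th0 : 0 < th by rewrite !mulr_gt0.
(* [z1] and [z2] are solved for so that the quadratic part and the sum over unit intervals each add
   at most [eta / 8 * L n] to the exponent. *)
pose z1 := eta / (16 * kap ^+ 2).
have z10 : 0 < z1 by rewrite divr_gt0// mulr_gt0// exprn_gt0.
pose z2 := eta / (8 * q1 * A * expR 1).
have z20 : 0 < z2.
  by rewrite divr_gt0// mulr_gt0 ?expR_gt0// mulr_gt0// mulr_gt0.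
have tn := tail_near kapi0 y0 z0.
have sm := second_moment_near z10.
have Lbig := near_powR_ge (8 / eta) Moo theta0.
(* This ensures [t * b >= 1], so that [b] itself lies in the window where the uniform tail bound
   holds. *)
have LbigA := near_powR_ge (1 / (q1 * A)) Moo theta0.
have lnL := near_ln_le Moo theta0 (divr_gt0 eta0 (ltr0n _ 8)).
have lnt := near_ln_le Moo th0 (divr_gt0 rho0 (ltr0n _ 2)).
have tbig := near_powR_ge (- ln z2 / (rho / 2)) Moo th0.
near=> n.
have n1 : (1 <= n)%N by near: n; exists 1%N.
have m1 : 1 <= M n := M1 n1.
have m0 : 0 < M n by rewrite (lt_le_trans ltr01).
have mn0 : M n != 0 by rewrite gt_eqF.
have [v sq /andP[v0 vle]] : exists2 v,
  (\int[P]_w (Y n w ^+ 2)%:E = v%:E)%E &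
  0 <= v <= z1 * M n `^ (alpha * (1 + eps) - 1) by near: n; exact: sm.
have L8 : 8 / eta <= L n by near: n; exact: Lbig.
have LA : 1 / (q1 * A) <= L n by near: n; exact: LbigA.
have lnM1 : ln (M n) <= eta / 8 * L n by near: n; exact: lnL.
have lnM2 : ln (M n) <= rho / 2 * M n `^ th by near: n; exact: lnt.
have tb1 : - ln z2 / (rho / 2) <= M n `^ th by near: n; exact: tbig.
have tu : forall u, kap^-1 * M n `^ (alpha * eps) <= u <= y * M n `^ alpha ->
    (((1 + z) * (- q * u `^ (1 - eps)))%:E <= lne (P [set w | u <= Y n w]%R))%E /\
    (lne (P [set w | u <= Y n w]%R) <= ((1 - z) * (- q * u `^ (1 - eps)))%:E)%E.
  by near: n; exact: tn.
have tP u : kap^-1 * M n `^ (alpha * eps) <= u <= y * M n `^ alpha ->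
    (P [set w | u <= Y n w]%R <= (expR (- (q2 * u `^ (1 - eps))))%:E)%E.
  move=> /tu[_]; rewrite lne_le_EFin//; congr (_ <= (expR _)%:E)%E.
  by rewrite /q2; ring.
set b := M n `^ alpha * y.
have b0 : 0 < b by rewrite mulr_gt0// powR_gt0.
have bE : b `^ (1 - eps) = A * L n.
  by rewrite /b mulrC powRM ?powR_ge0 ?(ltW y0)// -powRrM.
pose t := q1 * b `^ (- eps).
have t0 : 0 < t by rewrite mulr_gt0// powR_gt0.
have tE : t = kap * (M n `^ (alpha * eps))^-1.
  rewrite /t /b powRM ?powR_ge0 ?(ltW y0)// -powRrM mulrN (powRN (M n)) /kap.
  by ring.
have tiE : t^-1 = kap^-1 * M n `^ (alpha * eps).
  by rewrite tE invfM invrK.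
have tbE : t * b = q1 * (A * L n).
  rewrite -bE /t -mulrA; congr (_ * _).
  by rewrite -{2}(powRr1 (ltW b0)) -powRD ?(gt_eqF b0) ?implybT// addrC.
have tb0 : 0 <= t * b by rewrite mulr_ge0 ?ltW.
(* From [K <= t * b < K.+1], the unit intervals cover the truncated range while every threshold
   [k.+1%:R / t] with [k < K] stays at most [b]. *)
pose K := Num.truncn (t * b).
have /andP[K1 K2] := truncn_itv tb0.
pose D := expR (- (rho * M n `^ th)).
have D0 : 0 <= D by exact: expR_ge0.
have PD k : (k < K)%N ->
    (P [set w | k.+1%:R / t <= Y n w]%R <= (expR (- k.+1%:R) * D)%:E)%E.
  move=> kK; set u := k.+1%:R / t.
  have u1 : t^-1 <= u by rewrite /u ler_peMl ?ler1n// invr_ge0 ltW.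
  have u0 : 0 < u by rewrite (lt_le_trans _ u1)// invr_gt0.
  have ub : u <= b.
    by rewrite ler_pdivrMr// mulrC (le_trans _ K1)// ler_nat.
  have := tP u; rewrite -tiE u1 mulrC -/b ub => /(_ isT)/le_trans; apply.
  rewrite lee_fin -expRD ler_expR -opprD lerN2.
  (* Here [u <= b] gives [b ^ (- eps) <= u ^ (- eps)], so the linear exponent [t * u] is dominated
     by [q1 * u ^ (1 - eps)]. *)
  have ku : k.+1%:R <= q1 * u `^ (1 - eps).
    have -> : k.+1%:R = t * u by rewrite /u mulrC divfK// gt_eqF.
    rewrite /t -mulrA ler_wpM2l ?(ltW q10)//.
    rewrite -{1}(powRr1 (ltW u0)) -{1}(subrK eps 1) powRD ?(gt_eqF u0) ?implybT//.
    rewrite mulrCA ler_piMr ?powR_ge0// powRN mulrC ler_pdivrMr ?powR_gt0// mul1r.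
    by apply: ge0_ler_powR; rewrite ?nnegrE ?(ltW e0) ?(ltW u0) ?(ltW b0).
  have ru : rho * M n `^ th <= (q2 - q1) * u `^ (1 - eps).
    rewrite /rho -mulrA ler_wpM2l ?subr_ge0 ?(ltW q12)//.
    rewrite /th powRrM -powRM ?powR_ge0 ?(ltW kapi0)// -tiE.
    by apply: ge0_ler_powR; rewrite ?nnegrE ?invr_ge0 ?(ltW e1') ?(ltW t0) ?(ltW u0).
  by move: ku ru; lra.
have Pb : (P [set w | b <= Y n w]%R <= (expR (- (q1 * (A * L n))))%:E)%E.
  have := tP b; rewrite [X in b <= X]mulrC lexx andbT => h.
  have /h/le_trans : kap^-1 * M n `^ (alpha * eps) <= b.
    rewrite -tiE -div1r ler_pdivrMr// mulrC tbE.
    by move: LA; rewrite ler_pdivrMr ?mulr_gt0//; lra.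
  apply; rewrite lee_fin ler_expR bE lerN2 ler_wpM2r ?(ltW q12)//.
  by rewrite mulr_ge0 ?powR_ge0 ?ltW.
have := iid_sum_ge_le_tail (Yi_indep n1) (Yi_distr n1) t0 (ltW K2) (Ycentered n1) sq PD D0 Pb.
rewrite card_ord => /le_trans; apply; rewrite lee_fin -tbE -/(M n).
have Lpos : 0 < L n by exact: powR_gt0.
have s1 : M n * (2 * t ^+ 2 * v) <= eta / 8 * L n.
  set E := M n `^ (alpha * eps) in tE.
  have E0 : 0 < E by exact: powR_gt0.
  (* The exponents match because [alpha * (1 + eps)] equals [alpha * (1 - eps) + 2 * alpha * eps];
     the factor [E * E] cancels against [t ^+ 2]. *)
  have MLE : M n * M n `^ (alpha * (1 + eps) - 1) = L n * (E * E).
    rewrite mulr_powRB1// ?(ltW m0)//; last by rewrite mulr_gt0// addr_gt0.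
    by rewrite /L /E -!powRD ?mn0 ?implybT//; congr (_ `^ _); ring.
  have -> : eta / 8 = 2 * kap ^+ 2 * z1 by rewrite /z1; field; rewrite gt_eqF.
  rewrite tE mulrCA.
  have : M n * v <= z1 * (L n * (E * E)).
    by rewrite (le_trans (ler_wpM2l (ltW m0) vle))// mulrCA MLE.
  have c0 : 0 <= 2 * (kap / E) ^+ 2 by rewrite mulr_ge0// sqr_ge0.
  move=> /(ler_wpM2l c0)/le_trans; apply.
  by rewrite le_eqVlt; apply/orP; left; apply/eqP; field; rewrite gt_eqF.
have s2 : M n * (K%:R * (expR 1 * D)) <= eta / 8 * L n.
  (* Half of [rho] beats [ln (M n)], the other half beats [- ln z2]. *)
  have MD : M n * D <= z2.
    have -> : M n * D = expR (ln (M n) - rho * M n `^ th) by rewrite expRD lnK ?posrE.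
    rewrite -[leRHS]lnK ?posrE// ler_expR.
    by move: tb1; rewrite ler_pdivrMr ?divr_gt0//; lra.
  have e1_gt0 : 0 < expR 1 :> R by exact: expR_gt0.
  have -> : M n * (K%:R * (expR 1 * D)) = K%:R * expR 1 * (M n * D) by ring.
  apply: (@le_trans _ _ (q1 * (A * L n) * expR 1 * z2)).
    apply: ler_pM => //; first by rewrite mulr_ge0// ltW.
    by rewrite ler_pM2r// -tbE.
  rewrite le_eqVlt; apply/orP; left; apply/eqP; rewrite /z2; field.
  by rewrite !gt_eqF.
set Q := t * b.
have f1 : M n * expR (- Q) <= expR (- Q + eta / 4 * L n).
  rewrite -{1}[M n]lnK ?posrE// -expRD ler_expR addrC lerD2l (le_trans lnM1)//.
  by rewrite ler_wpM2r ?(ltW Lpos)//; lra.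
have f2 : expR (- Q + M n * (2 * t ^+ 2 * v + K%:R * (expR 1 * D))) <=
    expR (- Q + eta / 4 * L n).
  by rewrite ler_expR lerD2l mulrDr; lra.
apply: (le_trans (lerD f1 f2)).
(* The two equal bounds add up to a factor 2, at most [expR 1], and [L8] pays for this 1 in the
   exponent. *)
apply: (@le_trans _ _ (expR 1 * expR (- Q + eta / 4 * L n))).
  by have := expR_ge1Dx (1 : R); have := expR_gt0 (- Q + eta / 4 * L n); nra.
rewrite -expRD ler_expR.
move: L8; rewrite ler_pdivrMr// => L8.
have : z * q * A * L n <= eta / 4 * L n by rewrite ler_wpM2r// ltW.
by rewrite /Q tbE /q1 -/A; lra.
Unshelve. all: by end_near. Qed.

End weibull_tail.

(** * Conclusion by squeezing the normalized logarithm *)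

Theorem theorem1 (R : realType) (d : measure_display)
    (Omega : measurableType d) (P : probability Omega R)
    (N : nat -> nat) (Y : nat -> {RV P >-> R})
    (Yi : forall n : nat, 'I_(N n) -> {RV P >-> R})
    (eps q alpha : R)
    (Ngt0 : forall n : nat, (1 <= n)%N -> (1 <= N n)%N)
    (Noo : N @ \oo --> \oo)
    (Ycentered : forall n : nat, (1 <= n)%N -> centered (Y n))
    (Yi_indep : forall n : nat, (1 <= n)%N -> mutually_independent (Yi n))
    (Yi_distr : forall n : nat, (1 <= n)%N ->
      forall i : 'I_(N n), identically_distributed (Yi n i) (Y n))
    (eps01 : 0 < eps < 1) (q_gt0 : 0 < q) (alpha_gt : (1 + eps)^-1 < alpha)
    (tail : forall y : nat -> R,
      (forall n : nat, (1 <= n)%N -> 0 < y n) ->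
      asymp_le (fun n => (N n)%:R `^ (alpha * eps)) y ->
      asymp_le y (fun n => (N n)%:R `^ alpha) ->
      asymp_equiv (fun n => lne (P [set w | y n <= Y n w]))
                  (fun n => - q * y n `^ (1 - eps)))
    (second_moment :
      little_o (fun n => 'E_P[fun w => (Y n w ^+ 2)%R]%E)
                     (fun n => (N n)%:R `^ (alpha * (1 + eps) - 1))) :
  forall y : R, 0 <= y ->
    (fun n => (((N n)%:R `^ (alpha * (1 - eps)))^-1%:E *
               lne (P [set w | ((N n)%:R `^ alpha * y <=
                                \sum_(i < N n) Yi n i w)%R]))%E) @ \oo
      --> (- q * y `^ (1 - eps))%:E.
Proof.
move=> y y0.
have /andP[e0 e1] := eps01.
have alpha0 : 0 < alpha by rewrite (lt_trans _ alpha_gt)// invr_gt0 addr_gt0.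
have near_le (eta : R) : 0 < eta -> \forall n \near \oo,
    (P [set w | (N n)%:R `^ alpha * y <= \sum_(i < N n) Yi n i w]%R <=
      (expR (- ((q * y `^ (1 - eps) - eta) * (N n)%:R `^ (alpha * (1 - eps)))))%:E)%E.
  move=> eta0; have [y_gt0|] := ltP 0 y.
    exact: (sum_tail_le Ngt0 eps01 q_gt0 alpha0 tail Noo Ycentered Yi_indep
      Yi_distr second_moment).
  (* At 0 the target rate vanishes, so the bound is at least 1 and holds for any probability. *)
  move=> yle0; have -> : y = 0 by apply/le_anti; rewrite yle0.
  rewrite powR0 ?gt_eqF ?subr_gt0// mulr0 sub0r.
  apply: nearW => n; rewrite (le_trans (probability_le1 _ _))//.
    exact: measurable_iid_sum_ge.
  by rewrite mulNr opprK lee_fin -expR0 ler_expR mulr_ge0 ?powR_ge0// ltW.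
have h (eta : R) : 0 < eta -> \forall n \near \oo, exists2 r,
    (((N n)%:R `^ (alpha * (1 - eps)))^-1%:E *
       lne (P [set w | ((N n)%:R `^ alpha * y <= \sum_(i < N n) Yi n i w)%R]))%E = r%:E &
    `|- q * y `^ (1 - eps) - r| <= eta.
  move=> eta0.
  have lo := sum_tail_ge Ngt0 eps01 q_gt0 alpha0 tail Noo Ycentered Yi_indep
    Yi_distr second_moment y0 eta0.
  have hi := near_le _ eta0.
  near=> n.
  have n1 : (1 <= n)%N by near: n; exists 1%N.
  have L0 : 0 < (N n)%:R `^ (alpha * (1 - eps)) :> R.
    by rewrite powR_gt0// ltr0n Ngt0.
  have : (P [set w | (N n)%:R `^ alpha * y <= \sum_(i < N n) Yi n i w]%R <=
      (expR (- ((q * y `^ (1 - eps) - eta) * (N n)%:R `^ (alpha * (1 - eps)))))%:E)%E.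
    by near: n; exact: hi.
  have : ((expR (- ((q * y `^ (1 - eps) + eta) * (N n)%:R `^ (alpha * (1 - eps)))))%:E <=
      P [set w | (N n)%:R `^ alpha * y <= \sum_(i < N n) Yi n i w]%R)%E.
    by near: n; exact: lo.
  set p := P _; have p0 : (0 <= p)%E by exact: measure_ge0.
  rewrite -EFin_le_lne// -lne_le_EFin//.
  (* The two-sided bound rules out infinite logarithms; in particular the lower one excludes a
     vanishing probability. *)
  case: (lne p) => [r| |] //; rewrite !lee_fin => rlo rhi.
  exists (((N n)%:R `^ (alpha * (1 - eps)))^-1 * r) => //.
  rewrite ler_distlC; apply/andP; split.
    by rewrite ler_pdivlMl//; lra.
  by rewrite ler_pdivrMl//; lra.
apply/fine_cvgP; split; first by apply: filterS (h 1 ltr01) => n [r -> _].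
by apply/cvgrPdist_le => eta eta0; apply: filterS (h eta eta0) => n [r /= ->].
Unshelve. all: by end_near. Qed.
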